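(* Let $\mathcal{V}$ be a variety with a weak difference term, $\mathbf{A}\in\mathcal{V}$, $\theta$ a nonzero abelian congruence of $\mathbf{A}$, and $\alpha=(0:\theta)$. Let $\Delta=\Delta_{\theta,\alpha}$, let $\eta_1,\eta_2,\overline{\theta},\overline{\alpha}$ be as defined below, and let $\varepsilon=\overline{\theta}\wedge\Delta$ (all in $\mathrm{Con}(\mathbf{A}(\theta))$). Then: (1) For any $a\in A$, $(a,a)/\Delta=\{(b,b):(a,b)\in\alpha\}$. (2) $\Delta<\overline{\alpha}$ and $(\Delta:\overline{\alpha})=\overline{\alpha}$. (3) $\overline{\theta}$ is abelian, and the interval $I[0,\overline{\theta}]$ in $\mathrm{Con}(\mathbf{A}(\theta))$ is a modular lattice consisting of permuting congruences. (4) $\{0,\eta_1,\eta_2,\varepsilon,\overline{\theta}\}$ is a sublattice of $I[0,\overline{\theta}]$ isomorphic to $\mathbf{M}_3$. (5) Each of $(\varepsilon,\overline{\theta})$, $(0,\eta_1)$, $(0,\eta_2)$ transposes up to $(\Delta,\overline{\alpha})$. (6) If $\theta$ is minimal, i.e. $0\prec\theta$, then the interval $I[0,\overline{\theta}]$ has height $2$, $\Delta\prec\overline{\alpha}$, and $\Delta$ is completely meet-irreducible.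
   Context: For congruences $\varphi,\theta,\delta$ of an algebra, $C(\varphi,\theta;\delta)$ means: for every term $t(\bar x,\bar y)$, all pairs $(a_i,b_i)\in\varphi$ and $(c_j,d_j)\in\theta$, if $t(\bar a,\bar c)\equiv_\delta t(\bar a,\bar d)$ then $t(\bar b,\bar c)\equiv_\delta t(\bar b,\bar d)$. The centralizer $(\delta:\theta)$ is the largest congruence $\varphi$ with $C(\varphi,\theta;\delta)$; $\theta/\delta$ is abelian iff $C(\theta,\theta;\delta)$, $\theta$ abelian iff $C(\theta,\theta;0)$. A ternary term $d$ is a weak difference term for an algebra if it is idempotent and for all congruences $\delta\le\theta$ with $\theta/\delta$ abelian, $d(a,a,b)\equiv_\delta b\equiv_\delta d(b,a,a)$ for all $(a,b)\in\theta$; it is one for $\mathcal{V}$ if it is one for every member. $\mathbf{A}(\theta)$ is $\theta$ viewed as a subalgebra of $\mathbf{A}^2$. For $\varphi\in\mathrm{Con}(\mathbf{A})$, $\Delta_{\theta,\varphi}$ is the congruence of $\mathbf{A}(\theta)$ generated by $\{((a,a),(b,b)):(a,b)\in\varphi\}$. $\eta_i$ is the kernel of the $i$-th projection $\mathbf{A}(\theta)\to\mathbf{A}$. For $\beta\in\mathrm{Con}(\mathbf{A})$ with $\beta\ge\theta$, $\overline{\beta}=\{((a_1,a_2),(b_1,b_2))\in A(\theta)^2:(a_1,b_1)\in\beta\}$. A pair $(\sigma,\tau)$ with $\sigma\le\tau$ transposes up to $(\delta,\varepsilon)$ with $\delta\le\varepsilon$ if $\tau\wedge\delta=\sigma$ and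 $\tau\vee\delta=\varepsilon$. A congruence $\beta\neq1$ is completely meet-irreducible if there is $\beta^+\succ\beta$ with $\beta^+\le\gamma$ for every congruence $\gamma>\beta$. $\mathbf{M}_3$ is the five-element modular nondistributive lattice. *)

(* Defs.v *)
From HB Require Import structures.
From mathcomp Require Import all_boot all_order.
From mathcomp Require Import boolp classical_sets.

Set Implicit Arguments.
Unset Strict Implicit.
Unset Printing Implicit Defensive.

Import Order.TTheory.
Local Open Scope order_scope.

Record signature := Signature { symb :> Type; arity : symb -> nat }.

Record algebra (S : signature) := Algebra {
  carrier :> Type;
  carrier_inh : inhabited carrier;
  op : forall f : S, ('I_(arity f) -> carrier) -> carrier
}.
Arguments op {S} A f x : rename.

Inductive term (S : signature) (X : Type) : Type :=
| Var of X
| App (f : S) of 'I_(arity f) -> term S X.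
Arguments Var {S X} x.
Arguments App {S X} f ts.

Fixpoint eval (S : signature) (A : algebra S) (X : Type) (e : X -> A)
    (t : term S X) : A :=
  match t with
  | Var x => e x
  | App f ts => op A f (fun i => eval e (ts i))
  end.

Definition env2 (T : Type) (m n : nat) (x : 'I_m -> T) (y : 'I_n -> T) :
    'I_m + 'I_n -> T :=
  fun v => match v with inl i => x i | inr j => y j end.

Definition eval3 (S : signature) (A : algebra S) (d : term S 'I_3)
    (a b c : A) : A :=
  eval (tnth [tuple a; b; c]) d.

Definition hom (S : signature) (A B : algebra S) (h : A -> B) : Prop :=
  forall (f : S) (x : 'I_(arity f) -> A),
    h (op A f x) = op B f (fun i => h (x i)).

Lemma prod_inh (S : signature) (I : Type) (F : I -> algebra S) :
  inhabited (forall i, F i).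
Proof.
split=> i; apply: (projT1 (cid (P := fun=> True) _)).
by case: (carrier_inh (F i)) => x; exists x.
Qed.

Definition prod_algebra (S : signature) (I : Type) (F : I -> algebra S) :
    algebra S :=
  @Algebra S (forall i, F i) (prod_inh F)
    (fun f x i => op (F i) f (fun k => x k i)).

(* [variety_sub] is closure under isomorphic copies of subalgebras. *)
Record variety (S : signature) (V : set (algebra S)) : Prop := Variety {
  variety_img : forall (A B : algebra S) (h : A -> B),
    hom h -> (forall b, exists a, h a = b) -> V A -> V B;
  variety_sub : forall (A B : algebra S) (h : B -> A),
    hom h -> injective h -> V A -> V B;
  variety_prod : forall (I : Type) (F : I -> algebra S),
    (forall i, V (F i)) -> V (prod_algebra F)
}.

Record con (S : signature) (A : algebra S) := Con {
  con_rel :> A -> A -> Prop;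
  con_equiv : RelationClasses.Equivalence con_rel;
  con_op : forall (f : S) (x y : 'I_(arity f) -> A),
    (forall i, con_rel (x i) (y i)) -> con_rel (op A f x) (op A f y)
}.

Section ConTheory.
Context {S : signature} {A : algebra S}.
Implicit Types phi psi : con A.

Lemma con_refl phi a : phi a a.
Proof. by case: (con_equiv phi) => h _ _; apply: h. Qed.

Lemma con_sym phi a b : phi a b -> phi b a.
Proof. by case: (con_equiv phi) => _ h _; apply: h. Qed.

Lemma con_trans phi b a c : phi a b -> phi b c -> phi a c.
Proof. by case: (con_equiv phi) => _ _ h; apply: h. Qed.

Lemma con_ext phi psi : (forall a b, phi a b <-> psi a b) -> phi = psi.
Proof.
case: phi psi => [r er cr] [s es cs] /= rs.
have E : r = s by apply/funext => a; apply/funext => b; apply/propext.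
by subst s; congr Con; apply: Prop_irrelevance.
Qed.

Lemma con_bot_subproof : RelationClasses.Equivalence (@eq A).
Proof. by split=> // a b c -> ->. Qed.

Lemma con_bot_op (f : S) (x y : 'I_(arity f) -> A) :
  (forall i, x i = y i) -> op A f x = op A f y.
Proof. by move=> /funext ->. Qed.

Definition con_bot : con A := Con con_bot_subproof con_bot_op.

Lemma con_top_subproof : RelationClasses.Equivalence (fun _ _ : A => True).
Proof. by []. Qed.

Definition con_top : con A :=
  Con con_top_subproof (fun _ _ _ _ => I).

Lemma con_inf_subproof (F : set (con A)) :
  RelationClasses.Equivalence (fun a b => forall phi, F phi -> phi a b).
Proof.
split=> [a phi _|a b ab phi Fp|a b c ab bc phi Fp]; first exact: con_refl.
  by apply: con_sym; apply: ab.
by apply: con_trans (ab _ Fp) (bc _ Fp).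
Qed.

Lemma con_inf_op (F : set (con A)) (f : S) (x y : 'I_(arity f) -> A) :
  (forall i phi, F phi -> phi (x i) (y i)) ->
  forall phi, F phi -> phi (op A f x) (op A f y).
Proof. by move=> xy phi Fp; apply: con_op => i; apply: xy. Qed.

Definition con_inf (F : set (con A)) : con A :=
  Con (con_inf_subproof F) (@con_inf_op F).

Definition Cg (R : A -> A -> Prop) : con A :=
  con_inf (fun phi => forall a b, R a b -> phi a b).

Lemma Cg_gen (R : A -> A -> Prop) a b : R a b -> Cg R a b.
Proof. by move=> Rab phi; apply. Qed.

Lemma Cg_min (R : A -> A -> Prop) phi :
  (forall a b, R a b -> phi a b) -> forall a b, Cg R a b -> phi a b.
Proof. by move=> Rphi a b; apply. Qed.

Definition con_meet phi psi : con A :=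
  con_inf (fun chi => chi = phi \/ chi = psi).

Definition con_join phi psi : con A := Cg (fun a b => phi a b \/ psi a b).

Definition con_le phi psi : bool := `[< forall a b, phi a b -> psi a b >].

Lemma con_le_refl : reflexive con_le.
Proof. by move=> phi; apply/asboolP. Qed.

Lemma con_le_anti : antisymmetric con_le.
Proof.
move=> phi psi /andP[/asboolP h /asboolP k].
by apply: con_ext => a b; split=> [/h|/k].
Qed.

Lemma con_le_trans : transitive con_le.
Proof.
move=> psi phi chi /asboolP h /asboolP k.
by apply/asboolP => a b /h /k.
Qed.

Lemma con_lexI phi psi chi :
  con_le phi (con_meet psi chi) = con_le phi psi && con_le phi chi.
Proof.
apply/idP/andP => [/asboolP h|[/asboolP h /asboolP k]].
  by split; apply/asboolP => a b /h; apply; [left|right].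
by apply/asboolP => a b ab _ [->|->]; [apply: h|apply: k].
Qed.

Lemma con_leUx phi psi chi :
  con_le (con_join phi psi) chi = con_le phi chi && con_le psi chi.
Proof.
apply/idP/andP => [/asboolP h|[/asboolP h /asboolP k]].
  by split; apply/asboolP => a b ab; apply/h/Cg_gen; [left|right].
by apply/asboolP; apply: Cg_min => a b [/h|/k].
Qed.

Lemma con_le0x phi : con_le con_bot phi.
Proof. by apply/asboolP => a b ->; apply: con_refl. Qed.

Lemma con_lex1 phi : con_le phi con_top.
Proof. by apply/asboolP. Qed.

End ConTheory.

Fact con_display : Order.disp_t. Proof. exact: (Order.Disp tt tt). Qed.

HB.instance Definition _ (S : signature) (A : algebra S) :=
  gen_eqMixin (con A).
HB.instance Definition _ (S : signature) (A : algebra S) :=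
  gen_choiceMixin (con A).
HB.instance Definition _ (S : signature) (A : algebra S) :=
  Order.Le_isPOrder.Build con_display (con A)
    con_le_refl con_le_anti con_le_trans.
HB.instance Definition _ (S : signature) (A : algebra S) :=
  Order.POrder_isMeetSemilattice.Build con_display (con A) con_lexI.
HB.instance Definition _ (S : signature) (A : algebra S) :=
  Order.POrder_isJoinSemilattice.Build con_display (con A) con_leUx.
HB.instance Definition _ (S : signature) (A : algebra S) :=
  Order.hasBottom.Build con_display (con A) con_le0x.
HB.instance Definition _ (S : signature) (A : algebra S) :=
  Order.hasTop.Build con_display (con A) con_lex1.

Lemma con_leP (S : signature) (A : algebra S) (phi psi : con A) :
  reflect (forall a b, phi a b -> psi a b) (phi <= psi).
Proof. exact: asboolP. Qed.

Lemma con_botE (S : signature) (A : algebra S) (a b : A) :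
  (\bot : con A) a b <-> a = b.
Proof. by []. Qed.

Lemma con_topE (S : signature) (A : algebra S) (a b : A) :
  (\top : con A) a b <-> True.
Proof. by []. Qed.

Lemma con_meetE (S : signature) (A : algebra S) (phi psi : con A) (a b : A) :
  (phi `&` psi) a b <-> phi a b /\ psi a b.
Proof.
split=> [h|[h k] _ [->|->] //].
by split; apply: h; [left|right].
Qed.

Definition permute (S : signature) (A : algebra S) (phi psi : con A) : Prop :=
  forall a b : A,
    (exists2 c, phi a c & psi c b) <-> (exists2 c, psi a c & phi c b).

Section OrderNotions.
Context {d : Order.disp_t}.

Definition itv (L : porderType d) (x y : L) : set L :=
  fun z => x <= z <= y.

Definition covers (L : porderType d) (x y : L) : Prop :=
  x < y /\ forall z, ~ (x < z < y).

(* A lattice has height n when its longest chains have n + 1 elements. *)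
Definition has_height (L : porderType d) (X : set L) (n : nat) : Prop :=
  let chain (s : seq L) :=
    sorted <%O s /\ forall x, x \in s -> X x in
  (exists2 s, chain s & size s = n.+1) /\
  (forall s, chain s -> (size s <= n.+1)%N).

Definition sublattice (L : latticeType d) (X : set L) : Prop :=
  forall x y, X x -> X y -> X (x `&` y) /\ X (x `|` y).

Definition modular_sublattice (L : latticeType d) (X : set L) : Prop :=
  sublattice X /\
  forall x y z, X x -> X y -> X z ->
    x <= z -> x `|` (y `&` z) = (x `|` y) `&` z.

Definition sublattice_isomorphic_to (d' : Order.disp_t) (M : latticeType d')
    (L : latticeType d) (X : set L) : Prop :=
  sublattice X /\
  exists h : M -> L,
    [/\ injective h, forall x, X x <-> exists m, h m = x,
        {morph h : x y / x `&` y} & {morph h : x y / x `|` y}].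

Definition transposes_up (L : latticeType d) (sigma tau delta eps : L) : Prop :=
  [/\ sigma <= tau, delta <= eps,
      tau `&` delta = sigma & tau `|` delta = eps].

Definition completely_meet_irreducible (L : tPOrderType d) (b : L) : Prop :=
  b <> \top /\ exists2 b', covers b b' & forall c, b < c -> b' <= c.

End OrderNotions.
Arguments sublattice_isomorphic_to {d d'} M {L} X.

Inductive M3 : Set := M3_0 | M3_a | M3_b | M3_c | M3_1.

Definition M3_le (x y : M3) : bool :=
  match x, y with
  | M3_0, _ | _, M3_1 | M3_a, M3_a | M3_b, M3_b | M3_c, M3_c => true
  | _, _ => false
  end.

Definition M3_meet (x y : M3) : M3 :=
  if M3_le x y then x else if M3_le y x then y else M3_0.

Definition M3_join (x y : M3) : M3 :=
  if M3_le x y then y else if M3_le y x then x else M3_1.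

Lemma M3_le_refl : reflexive M3_le. Proof. by case. Qed.
Lemma M3_le_anti : antisymmetric M3_le. Proof. by case; case. Qed.
Lemma M3_le_trans : transitive M3_le. Proof. by case; case; case. Qed.
Lemma M3_lexI x y z : M3_le x (M3_meet y z) = M3_le x y && M3_le x z.
Proof. by case: x; case: y; case: z. Qed.
Lemma M3_leUx x y z : M3_le (M3_join x y) z = M3_le x z && M3_le y z.
Proof. by case: x; case: y; case: z. Qed.

Fact M3_display : Order.disp_t. Proof. exact: (Order.Disp tt tt). Qed.

HB.instance Definition _ := gen_eqMixin M3.
HB.instance Definition _ := gen_choiceMixin M3.
HB.instance Definition _ :=
  Order.Le_isPOrder.Build M3_display M3 M3_le_refl M3_le_anti M3_le_trans.
HB.instance Definition _ :=
  Order.POrder_isMeetSemilattice.Build M3_display M3 M3_lexI.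
HB.instance Definition _ :=
  Order.POrder_isJoinSemilattice.Build M3_display M3 M3_leUx.

Definition centralizes (S : signature) (A : algebra S)
    (phi theta delta : con A) : Prop :=
  forall (m n : nat) (t : term S ('I_m + 'I_n))
    (a b : 'I_m -> A) (c d : 'I_n -> A),
    (forall i, phi (a i) (b i)) -> (forall j, theta (c j) (d j)) ->
    delta (eval (env2 a c) t) (eval (env2 a d) t) ->
    delta (eval (env2 b c) t) (eval (env2 b d) t).

(* [centralizer delta theta] is (delta : theta). It is defined as the join of
   the congruences that centralize theta modulo delta, and [centralizerP]
   shows that it is the largest of them. *)
Definition centralizer (S : signature) (A : algebra S) (delta theta : con A) :
    con A :=
  Cg (fun a b => exists2 phi : con A, centralizes phi theta delta & phi a b).

(* For delta <= theta: theta / delta is an abelian congruence of A / delta. *)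
Definition abelian_mod (S : signature) (A : algebra S) (theta delta : con A) :
    Prop :=
  centralizes theta theta delta.

Definition abelian (S : signature) (A : algebra S) (theta : con A) : Prop :=
  abelian_mod theta \bot.

Section CentralizerP.
Context {S : signature} {A : algebra S}.
Variables delta theta : con A.

Fixpoint subst (X Y : Type) (s : X -> term S Y) (t : term S X) : term S Y :=
  match t with
  | Var x => s x
  | App f ts => App f (fun i => subst s (ts i))
  end.

Lemma eval_subst (X Y : Type) (s : X -> term S Y) (e : Y -> A) t :
  eval e (subst s t) = eval (fun x => eval e (s x)) t.
Proof.
elim: t => [//|f ts IH] /=.
by congr (op A f); apply/funext.
Qed.

Definition upd (m : nat) (p : 'I_m -> A) (i : 'I_m) (a : A) : 'I_m -> A :=
  fun k => if k == i then a else p k.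

Definition exchangeable (a b : A) : Prop :=
  forall (m n : nat) (t : term S ('I_m + 'I_n)) (i : 'I_m) (p : 'I_m -> A)
    (c d : 'I_n -> A), (forall j, theta (c j) (d j)) ->
    delta (eval (env2 (upd p i a) c) t) (eval (env2 (upd p i a) d) t) <->
    delta (eval (env2 (upd p i b) c) t) (eval (env2 (upd p i b) d) t).

Definition hybrid (m : nat) (a b : 'I_m -> A) (k : nat) : 'I_m -> A :=
  fun i => if (i < k)%N then b i else a i.

Lemma hybrid0 m (a b : 'I_m -> A) : hybrid a b 0 = a.
Proof. by apply/funext. Qed.

Lemma hybrid_max m (a b : 'I_m -> A) : hybrid a b m = b.
Proof. by apply/funext => i; rewrite /hybrid ltn_ord. Qed.

Lemma hybridS m (a b : 'I_m -> A) (k : 'I_m) :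
  hybrid a b k.+1 = upd (hybrid a b k) k (b k).
Proof.
apply/funext => i; rewrite /hybrid /upd ltnS leq_eqVlt -val_eqE /=.
by case: eqP => //= /val_inj ->.
Qed.

Lemma hybrid_upd m (a b : 'I_m -> A) (k : 'I_m) :
  hybrid a b k = upd (hybrid a b k) k (a k).
Proof.
apply/funext => i; rewrite /upd.
by case: eqP => // ->; rewrite /hybrid ltnn.
Qed.

Lemma exchangeable_all m n (t : term S ('I_m + 'I_n)) (a b : 'I_m -> A)
    (c d : 'I_n -> A) :
  (forall i, exchangeable (a i) (b i)) -> (forall j, theta (c j) (d j)) ->
  delta (eval (env2 a c) t) (eval (env2 a d) t) <->
  delta (eval (env2 b c) t) (eval (env2 b d) t).
Proof.
move=> ab cd.
suff H k : (k <= m)%N ->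
    delta (eval (env2 a c) t) (eval (env2 a d) t) <->
    delta (eval (env2 (hybrid a b k) c) t) (eval (env2 (hybrid a b k) d) t).
  by rewrite (H m) // hybrid_max.
elim: k => [|k IH] km; first by rewrite hybrid0.
rewrite (IH (ltnW km)); have /= -> := hybridS a b (Ordinal km).
have /= {1 2}-> := hybrid_upd a b (Ordinal km).
exact: ab.
Qed.

Lemma exchangeable_equiv : RelationClasses.Equivalence exchangeable.
Proof.
split=> [a m n t i p c d cd //|a b ab m n t i p c d cd|].
  by rewrite (ab _ _ t i p c d cd).
move=> a b e ab be m n t i p c d cd.
by rewrite (ab _ _ t i p c d cd) (be _ _ t i p c d cd).
Qed.

Lemma exchangeable_op (f : S) (x y : 'I_(arity f) -> A) :
  (forall i, exchangeable (x i) (y i)) ->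
  exchangeable (op A f x) (op A f y).
Proof.
move=> xy m n t i p c d cd.
pose s (v : 'I_m + 'I_n) : term S ('I_(m + arity f) + 'I_n) :=
  match v with
  | inl k => if k == i then App f (fun l => Var (inl (rshift m l)))
             else Var (inl (lshift (arity f) k))
  | inr j => Var (inr j)
  end.
pose q (z : 'I_(arity f) -> A) (k : 'I_(m + arity f)) :=
  match split k with inl k => p k | inr l => z l end.
have E z e : eval (env2 (q z) e) (subst s t) =
             eval (env2 (upd p i (op A f z)) e) t.
  rewrite eval_subst; congr eval; apply/funext => -[k|j] //=.
  rewrite /upd; case: eqP => _ /=; last by rewrite /q (unsplitK (inl k)).
  by congr (op A f); apply/funext => l; rewrite /q (unsplitK (inr l)).
rewrite -!E; apply: exchangeable_all => // k.
rewrite /q; case: (split k) => l; last exact: xy.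
by case: exchangeable_equiv => h _ _; apply: h.
Qed.

Lemma centralizes_exchangeable (phi : con A) :
  centralizes phi theta delta -> forall a b, phi a b -> exchangeable a b.
Proof.
move=> C a b ab m n t i p c d cd.
have U a' b' : phi a' b' -> forall k, phi (upd p i a' k) (upd p i b' k).
  by move=> h k; rewrite /upd; case: eqP => // _; apply: con_refl.
by split; apply: C => //; apply: U => //; apply: con_sym.
Qed.

Lemma centralizerP :
  centralizes (centralizer delta theta) theta delta /\
  forall phi : con A, centralizes phi theta delta ->
    phi <= centralizer delta theta.
Proof.
split; last first.
  by move=> phi C; apply/con_leP => a b ab; apply: Cg_gen; exists phi.
move=> m n t a b c d ab cd; apply: (iffLR (exchangeable_all _ _ cd)) => i.
apply: (@Cg_min _ _ _ (Con exchangeable_equiv exchangeable_op)) (ab i).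
by move=> x y [phi C]; apply: centralizes_exchangeable.
Qed.

End CentralizerP.

Definition weak_difference_term (S : signature) (A : algebra S)
    (d : term S 'I_3) : Prop :=
  (forall a : A, eval3 d a a a = a) /\
  forall delta theta : con A, delta <= theta -> abelian_mod theta delta ->
    forall a b : A, theta a b ->
      delta (eval3 d a a b) b /\ delta b (eval3 d b a a).

Definition has_weak_difference_term (S : signature) (V : set (algebra S)) :
    Prop :=
  exists d : term S 'I_3,
    forall A : algebra S, V A -> weak_difference_term A d.

Section PairAlgebra.
Context {S : signature} {A : algebra S}.
Variable theta : con A.

Definition pair_carrier : Type := {p : A * A | theta p.1 p.2}.

Definition mkpair (a b : A) (ab : theta a b) : pair_carrier :=
  exist (fun p : A * A => theta p.1 p.2) (a, b) ab.

Definition diag (a : A) : pair_carrier := mkpair (con_refl theta a).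

Lemma pair_inh : inhabited pair_carrier.
Proof. by case: (carrier_inh A) => a; split; apply: (diag a). Qed.

Definition pair_algebra : algebra S :=
  @Algebra S pair_carrier pair_inh (fun f x =>
    mkpair (con_op (c := theta) (f := f) (x := fun i => (sval (x i)).1)
              (y := fun i => (sval (x i)).2) (fun i => svalP (x i)))).

Lemma pullback_equiv (pr : pair_algebra -> A) (phi : con A) :
  RelationClasses.Equivalence (fun p q => phi (pr p) (pr q)).
Proof.
split=> [p|p q|p q r]; first exact: con_refl.
  exact: con_sym.
exact: con_trans.
Qed.

Lemma fst_op (phi : con A) (f : S) (x y : 'I_(arity f) -> pair_algebra) :
  (forall i, phi (sval (x i)).1 (sval (y i)).1) ->
  phi (sval (op pair_algebra f x)).1 (sval (op pair_algebra f y)).1.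
Proof. exact: con_op. Qed.

Lemma snd_op (phi : con A) (f : S) (x y : 'I_(arity f) -> pair_algebra) :
  (forall i, phi (sval (x i)).2 (sval (y i)).2) ->
  phi (sval (op pair_algebra f x)).2 (sval (op pair_algebra f y)).2.
Proof. exact: con_op. Qed.

(* The congruence written beta with an overline; only used for
   theta <= beta. *)
Definition overline (beta : con A) : con pair_algebra :=
  Con (pullback_equiv (fun p => (sval p).1) beta) (@fst_op beta).

Definition eta1 : con pair_algebra :=
  Con (pullback_equiv (fun p => (sval p).1) \bot) (@fst_op \bot).

Definition eta2 : con pair_algebra :=
  Con (pullback_equiv (fun p => (sval p).2) \bot) (@snd_op \bot).

Definition Delta_con (phi : con A) : con pair_algebra :=
  Cg (fun p q : pair_algebra =>
        exists a b, [/\ phi a b, p = diag a & q = diag b]).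

End PairAlgebra.

(* Main.v *)
(* Membership in the diagonal of A(theta) is invariant under the generators of
   Delta, by C(alpha, theta; 0); hence the diagonal is a union of Delta-classes,
   which is (1). The term d is a Mal'cev operation on theta-blocks, so if
   p = (a,b) and q = (a,c) are Delta-related, then applying d( - , p, (a,a))
   shows that d(c,b,a) = a, and c = b since theta is abelian. So eta_1 and Delta
   meet in 0. Moreover alpha-bar = Delta o eta_1 o Delta: if p and q have first
   coordinates a alpha b, then d(p,(a,a),(b,b)) and d((a,a),(a,a),q) are
   Delta-related to p and q and have the same first coordinate. This transfers
   the abelianness of eta_1 to alpha-bar modulo Delta, and turns covers of 0 by
   eta_1 into covers of Delta by alpha-bar. If gamma > Delta does not contain
   alpha-bar, then gamma meets alpha-bar in Delta, so gamma centralizes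
   alpha-bar modulo Delta and lies below (Delta : alpha-bar) = alpha-bar. *)
Require Import Defs.
From mathcomp Require Import all_boot all_order.
From mathcomp Require Import boolp classical_sets.

Set Implicit Arguments.
Unset Strict Implicit.
Unset Printing Implicit Defensive.

Import Order.TTheory.
Local Open Scope order_scope.

(** * Term evaluation under congruences and homomorphisms *)

Section Evaluation.
Context {S : signature}.
Implicit Types A B : algebra S.

Lemma con_eval A (phi : con A) (X : Type) (e e' : X -> A) (t : term S X) :
  (forall x, phi (e x) (e' x)) -> phi (eval e t) (eval e' t).
Proof. by move=> ee'; elim: t => [x|f ts IH] /=; [|apply: con_op]. Qed.

Lemma con_eval3 A (phi : con A) (d : term S 'I_3) a b c a' b' c' :
  phi a a' -> phi b b' -> phi c c' ->
  phi (eval3 d a b c) (eval3 d a' b' c').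
Proof. by move=> *; apply: con_eval => -[[|[|[|]]]]. Qed.

Lemma hom_eval A B (h : A -> B) (X : Type) (e : X -> A) (t : term S X) :
  hom h -> h (eval e t) = eval (h \o e) t.
Proof.
by move=> hh; elim: t => [//|f ts IH] /=; rewrite hh; congr op; apply/funext.
Qed.

Lemma hom_eval3 A B (h : A -> B) (d : term S 'I_3) a b c :
  hom h -> h (eval3 d a b c) = eval3 d (h a) (h b) (h c).
Proof.
move=> hh; rewrite /eval3 (hom_eval _ _ hh); congr eval; apply/funext.
by case=> -[|[|[|]]].
Qed.

Lemma hom_env2 A B (h : A -> B) m n (x : 'I_m -> A) (y : 'I_n -> A)
    (t : term S ('I_m + 'I_n)) :
  hom h -> h (eval (env2 x y) t) = eval (env2 (h \o x) (h \o y)) t.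
Proof.
by move=> hh; rewrite (hom_eval _ _ hh); congr eval; apply/funext => -[].
Qed.

(** The term condition for [d] once [s] regroups its variables: the first varies along [theta], the
    third along [phi], and the middle one stays constant. *)
Lemma eval3_centralizes A (phi theta delta : con A) (d : term S 'I_3)
    x x' y z z' :
  centralizes phi theta delta -> theta x x' -> phi z z' ->
  delta (eval3 d x y z) (eval3 d x' y z) ->
  delta (eval3 d x y z') (eval3 d x' y z').
Proof.
move=> C xx' zz'.
pose s (i : 'I_3) : term S ('I_2 + 'I_1) :=
  tnth [tuple Var (inr ord0); Var (inl ord0); Var (inl ord_max)] i.
have E u w : eval3 d u y w =
    eval (env2 (tnth [tuple y; w]) (fun=> u)) (subst s d).
  rewrite eval_subst; congr eval; apply/funext.
  by case=> -[|[|[|]]].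
by rewrite !E; apply: C => // -[[|[|]]] // ?; apply: con_refl.
Qed.

End Evaluation.

(** * Permuting congruences, modularity and centralizers *)

Section CongruenceLattice.
Context {S : signature} {A : algebra S}.
Implicit Types phi psi chi delta : con A.

Lemma con_le_app phi psi a b : phi <= psi -> phi a b -> psi a b.
Proof. by move/con_leP; apply. Qed.

Lemma con_joinl phi psi a b : phi a b -> (phi `|` psi) a b.
Proof. exact/con_le_app/leUl. Qed.

Lemma con_joinr phi psi a b : psi a b -> (phi `|` psi) a b.
Proof. exact/con_le_app/leUr. Qed.

Lemma con_preim_op (B : algebra S) (h : A -> B) (hh : hom h) (gamma : con B)
    (f : S) (x y : 'I_(arity f) -> A) :
  (forall i, gamma (h (x i)) (h (y i))) ->
  gamma (h (op A f x)) (h (op A f y)).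
Proof. by move=> xy; rewrite !hh; apply: con_op. Qed.

Lemma con_preim_equiv (B : algebra S) (h : A -> B) (gamma : con B) :
  RelationClasses.Equivalence (fun a b => gamma (h a) (h b)).
Proof.
by split=> [a|a b|a b c]; [apply: con_refl|apply: con_sym|apply: con_trans].
Qed.

Definition con_preim (B : algebra S) (h : A -> B) (hh : hom h)
    (gamma : con B) : con A :=
  Con (con_preim_equiv h gamma) (@con_preim_op B h hh gamma).

Lemma permute_sub phi psi :
  (forall a b c, phi a c -> psi c b -> exists2 e, psi a e & phi e b) ->
  permute phi psi.
Proof.
move=> H a b; split=> -[c ac cb]; first exact: H ac cb.
have [e be ea] := H _ _ _ (con_sym cb) (con_sym ac).
by exists e; apply: con_sym.
Qed.

Lemma malcev_permute (d : term S 'I_3) (top : con A) phi psi :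
  (forall a b, top a b -> eval3 d a a b = b /\ eval3 d b a a = b) ->
  phi <= top -> psi <= top -> permute phi psi.
Proof.
move=> malcev phit psit; apply: permute_sub => a b c ac cb.
have [E _] := malcev _ _ (con_le_app psit cb).
have [_ E'] := malcev _ _ (con_sym (con_le_app phit ac)).
(* From [a phi c psi b] follows [a = d(a,c,c) psi d(a,c,b) phi d(c,c,b) = b]. *)
exists (eval3 d a c b).
  by rewrite -[X in psi X]E'; apply: con_eval3 => //; apply: con_refl.
by rewrite -[X in phi _ X]E; apply: con_eval3 => //; apply: con_refl.
Qed.

(** Permutability makes the relational product of [phi] and [psi] an equivalence, hence a congruence
    containing both. *)
Lemma permute_join phi psi a b :
  permute phi psi -> (phi `|` psi) a b -> exists2 c, phi a c & psi c b.
Proof.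
move=> pp; pose R a b := exists2 c, phi a c & psi c b.
have Req : RelationClasses.Equivalence R.
  split=> [x|x y [z xz zy]|x y z [u xu uy] [v yv vz]].
  - by exists x; apply: con_refl.
  - by apply/pp; exists z; apply: con_sym.
  - have [w uw wv] : exists2 w, phi u w & psi w v by apply/pp; exists y.
    by exists w; [apply: con_trans xu uw | apply: con_trans wv vz].
have Rop (f : S) (x y : 'I_(arity f) -> A) :
    (forall i, R (x i) (y i)) -> R (op A f x) (op A f y).
  move=> xy; pose z i := projT1 (cid2 (xy i)).
  by exists (op A f z); apply: con_op => i; rewrite /z; case: cid2.
apply: (@Cg_min _ _ _ (Con Req Rop)) => x y /= [xy|xy].
  by exists y => //; apply: con_refl.
by exists x => //; apply: con_refl.
Qed.

(** The intermediate [c] stays in the [chi]-class of [a] because [phi <= chi], so [(c,b)] lies in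
    both [psi] and [chi]. *)
Lemma permute_modular phi psi chi :
  permute phi psi -> phi <= chi ->
  phi `|` (psi `&` chi) = (phi `|` psi) `&` chi.
Proof.
move=> pp le; apply/le_anti/andP; split.
  by rewrite leUx !lexI leUl le leIr leIxl ?leUr.
apply/con_leP => a b /con_meetE[/(permute_join pp)[c ac cb] ab].
apply: (@con_trans _ _ _ c); first exact: con_joinl.
apply/con_joinr/con_meetE; split=> //.
by apply: con_trans ab; apply/con_sym/(con_le_app le).
Qed.

Lemma permute_modular_sublattice (top : con A) :
  (forall phi psi, itv \bot top phi -> itv \bot top psi -> permute phi psi) ->
  modular_sublattice (itv \bot top).
Proof.
move=> pp; split=> [x y /andP[_ xt] /andP[_ yt]|x y z Ix Iy _ xz].
  by split; rewrite /itv /= le0x /= ?leUx ?xt // leIxl.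
by apply: permute_modular => //; apply: pp.
Qed.

(** Modulo [phi], [a] may be replaced by [b]; modulo [psi], [c] and [d] already agree. *)
Lemma centralizes_meet phi psi : centralizes phi psi (phi `&` psi).
Proof.
move=> m n t a b c d ab cd /con_meetE[h _]; apply/con_meetE; split.
  have E e : phi (eval (env2 a e) t) (eval (env2 b e) t).
    by apply: con_eval => -[i|j] //=; apply: con_refl.
  exact: con_trans (con_sym (E c)) (con_trans h (E d)).
by apply: con_eval => -[i|j] //=; apply: con_refl.
Qed.

Lemma centralizes_mono phi psi phi' psi' delta :
  phi' <= phi -> psi' <= psi -> centralizes phi psi delta ->
  centralizes phi' psi' delta.
Proof.
move=> le le' C m n t a b c d ab cd; apply: C => i.
  exact: con_le_app le _.
exact: con_le_app le' _.
Qed.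

(** The term condition modulo [delta] is blind to replacing arguments by [delta]-equivalent ones. *)
Lemma centralizes_saturate phi psi phi' psi' delta :
  (forall a b, phi' a b ->
     exists a' b', [/\ delta a a', phi a' b' & delta b' b]) ->
  (forall a b, psi' a b ->
     exists a' b', [/\ delta a a', psi a' b' & delta b' b]) ->
  centralizes phi psi delta -> centralizes phi' psi' delta.
Proof.
move=> fat fat' C m n t a b c d ab cd h.
have [a' Ha] := choice (fun i => fat _ _ (ab i)).
have [b' Hb] := choice Ha.
have [c' Hc] := choice (fun j => fat' _ _ (cd j)).
have [d' Hd] := choice Hc.
have E (x x' : 'I_m -> A) (y y' : 'I_n -> A) :
    (forall i, delta (x i) (x' i)) -> (forall j, delta (y j) (y' j)) ->
    delta (eval (env2 x y) t) (eval (env2 x' y') t).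
  by move=> xx' yy'; apply: con_eval => -[].
have aa' i : delta (a i) (a' i) by case: (Hb i).
have bb' i : delta (b i) (b' i) by apply: con_sym; case: (Hb i).
have cc' j : delta (c j) (c' j) by case: (Hd j).
have dd' j : delta (d j) (d' j) by apply: con_sym; case: (Hd j).
apply: con_trans (E _ _ _ _ bb' cc') _.
apply: con_trans (con_sym (E _ _ _ _ bb' dd')).
apply: (C _ _ t a').
- by move=> i; case: (Hb i).
- by move=> j; case: (Hd j).
apply: con_trans (con_sym (E _ _ _ _ aa' cc')) _.
exact: con_trans h (E _ _ _ _ aa' dd').
Qed.

(** Exchangeable pairs form a congruence that centralizes [theta] modulo [delta], so membership in
    the centralizer can be tested one pair and one variable at a time. *)
Lemma centralizer_exchangeable (theta delta : con A) a b :
  centralizer delta theta a b <-> exchangeable delta theta a b.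
Proof.
have [C max] := centralizerP delta theta.
split; first exact: (centralizes_exchangeable C).
pose ex := Con (@exchangeable_equiv S A delta theta)
               (@exchangeable_op S A delta theta).
apply: (@con_le_app ex); apply: max => m n t x y c d xy cd.
exact: (iffLR (exchangeable_all t xy cd)).
Qed.

Lemma centralizes_le (theta delta phi : con A) :
  centralizes phi theta delta -> phi <= centralizer delta theta.
Proof. by case: (centralizerP delta theta) => _; apply. Qed.

End CongruenceLattice.

(* The syntactic congruence of [D], in the sense of formal languages. When [D]
   is the diagonal of A(theta), C(phi, theta; 0) says exactly that it contains
   the generators of Delta_{theta,phi}. *)
Section SyntacticCongruence.
Context {S : signature} {A : algebra S} (D : A -> Prop).

Definition syntactic (a b : A) : Prop :=
  forall n (t : term S ('I_1 + 'I_n)) (r : 'I_n -> A),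
    D (eval (env2 (fun=> a) r) t) <-> D (eval (env2 (fun=> b) r) t).

Lemma syntactic_equiv : RelationClasses.Equivalence syntactic.
Proof.
split=> [a n t r //|a b ab n t r|a b c ab bc n t r].
  by rewrite (ab _ t r).
by rewrite (ab _ t r).
Qed.

(** The fixed arguments [z] of [f] become additional parameters of the test term. *)
Lemma syntactic_upd (f : S) (z : 'I_(arity f) -> A) (i : 'I_(arity f)) x y :
  syntactic x y -> syntactic (op A f (upd z i x)) (op A f (upd z i y)).
Proof.
move=> xy n t r.
pose s (v : 'I_1 + 'I_n) : term S ('I_1 + 'I_(n + arity f)) :=
  match v with
  | inl _ => App f (fun k => if k == i then Var (inl ord0)
                             else Var (inr (rshift n k)))
  | inr j => Var (inr (lshift (arity f) j))
  end.
pose q (k : 'I_(n + arity f)) :=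
  match split k with inl j => r j | inr l => z l end.
have E w : eval (env2 (fun=> op A f (upd z i w)) r) t =
           eval (env2 (fun=> w) q) (subst s t).
  rewrite eval_subst; congr eval; apply/funext => -[k|j] /=.
    congr (op A f); apply/funext => l; rewrite /upd.
    by case: eqP => //= _; rewrite /q (unsplitK (inr l)).
  by rewrite /q (unsplitK (inl j)).
by rewrite !E; apply: xy.
Qed.

Lemma syntactic_op (f : S) (x y : 'I_(arity f) -> A) :
  (forall i, syntactic (x i) (y i)) -> syntactic (op A f x) (op A f y).
Proof.
have [refl _ trans] := syntactic_equiv; move=> xy.
suff H k : (k <= arity f)%N -> syntactic (op A f x) (op A f (hybrid x y k)).
  by have := H _ (leqnn _); rewrite hybrid_max.
elim: k => [|k IH] km; first by rewrite hybrid0.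
apply: (trans _ _ _ (IH (ltnW km))).
have /= -> := hybridS x y (Ordinal km).
have /= {1}-> := hybrid_upd x y (Ordinal km).
exact/syntactic_upd/xy.
Qed.

Definition syntactic_con : con A := Con syntactic_equiv syntactic_op.

Lemma syntactic_saturated a b : syntactic_con a b -> D a -> D b.
Proof.
by move=> ab; have /= [] := ab 0%N (Var (inl ord0)) (fun i => a).
Qed.

End SyntacticCongruence.

(** * [M3] sublattices, and heights and covers in modular lattices *)

Section LatticeFacts.
Context {d : Order.disp_t}.

(** One inequality separates all five elements. If [z] were one of [a], [b], [c], the other two
    would both equal [u], and their meet would give [z = u]; [nu] is the dual argument. Two equal
    middle elements would equal their meet [z]. *)
Lemma sublattice_isomorphic_to_M3 (L : latticeType d) (z a b c u : L) :
  z <> u -> a `&` b = z -> a `&` c = z -> b `&` c = z ->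
  a `|` b = u -> a `|` c = u -> b `|` c = u ->
  sublattice_isomorphic_to M3 [set z; a; b; c; u]%classic.
Proof.
move=> zu ab ac bc ab' ac' bc'.
have nz x y w : x `|` y = u -> x `|` w = u -> y `&` w = z -> z <= y ->
    z <= w -> z <> x.
  by move=> xy xw yw zy zw E; apply: zu; move: xy xw yw; rewrite -E;
    rewrite (join_r zy) (join_r zw) => -> ->; rewrite meetxx.
have nu x y w : x `&` y = z -> x `&` w = z -> y `|` w = u -> y <= u ->
    w <= u -> x <> u.
  by move=> xy xw yw yu wu E; apply: zu; move: xy xw yw; rewrite E;
    rewrite (meet_r yu) (meet_r wu) => -> ->; rewrite joinxx.
have za : z <= a by rewrite -ab leIl.
have zb : z <= b by rewrite -ab leIr.
have zc : z <= c by rewrite -ac leIr.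
have au : a <= u by rewrite -ab' leUl.
have bu : b <= u by rewrite -ab' leUr.
have cu : c <= u by rewrite -ac' leUr.
have nza : z <> a := nz _ _ _ ab' ac' bc zb zc.
have nzb : z <> b by apply: (nz _ a c) => //; rewrite joinC.
have nzc : z <> c by apply: (nz _ a b) => //; rewrite joinC.
have nau : a <> u := nu _ _ _ ab ac bc' bu cu.
have nbu : b <> u by apply: (nu _ a c) => //; rewrite meetC.
have ncu : c <> u by apply: (nu _ a b) => //; rewrite meetC.
have nab : a <> b by move=> E; apply: nza; rewrite -ab -E meetxx.
have nac : a <> c by move=> E; apply: nza; rewrite -ac -E meetxx.
have nbc : b <> c by move=> E; apply: nzb; rewrite -bc -E meetxx.
pose h (x : M3) : L :=
  match x with
  | M3_0 => z | M3_a => a | M3_b => b | M3_c => c | M3_1 => u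
  end.
have zu' := le_trans za au.
have hI : {morph h : x y / x `&` y}.
  have H x y : h (M3_meet x y) = h x `&` h y.
    case: x y => -[] /=;
    by [|rewrite meetxx|rewrite meet_l|rewrite meet_r|rewrite meetC].
  by move=> x y; rewrite -H.
have hU : {morph h : x y / x `|` y}.
  have H x y : h (M3_join x y) = h x `|` h y.
    case: x y => -[] /=;
    by [|rewrite joinxx|rewrite join_l|rewrite join_r|rewrite joinC].
  by move=> x y; rewrite -H.
have hX x : [set z; a; b; c; u]%classic x <-> exists m, h m = x.
  split; last by case=> -[] <- /=; tauto.
  by case=> [[[[]|]|]|] ->;
    [exists M3_0|exists M3_a|exists M3_b|exists M3_c|exists M3_1].
split.
  move=> x y /hX[m <-] /hX[k <-].
  by split; apply/hX; [exists (m `&` k)|exists (m `|` k)].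
exists h; split=> //.
by move=> [] [] //= E; exfalso; auto.
Qed.

Lemma size_chain_rank (L : porderType d) (X : set L) (r : L -> nat) (n : nat)
    (s : seq L) :
  (forall x y, X x -> X y -> x < y -> (r x < r y)%N) ->
  (forall x, X x -> (r x <= n)%N) ->
  sorted <%O s -> (forall x, x \in s -> X x) -> (size s <= n.+1)%N.
Proof.
move=> r_mono r_le; case: s => [//|x s] /= xs sX; rewrite ltnS.
suff H : (r x + size s <= n)%N by apply: leq_trans H; apply: leq_addl.
elim: s x xs sX => [|y s IH] x /= => [_ sX|/andP[xy ys] sX].
  by rewrite addn0; apply/r_le/sX; rewrite inE.
have Xx : X x by apply: sX; rewrite inE eqxx.
have Xy : X y by apply: sX; rewrite !inE eqxx orbT.
rewrite addnS -addSn; apply: leq_trans (IH y ys _).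
  by rewrite leq_add2r r_mono.
by move=> w ws; apply: sX; rewrite inE ws orbT.
Qed.

(* In a modular lattice, comparable elements with the same meet and the same
   join with [a] are equal, so [r] below is a strictly monotone rank. *)
Lemma modular_height2 (L : tbLatticeType d) (a u : L) :
  modular_sublattice (itv \bot u) -> covers \bot a -> covers a u ->
  has_height (itv \bot u) 2.
Proof.
move=> [sub modu] [a0 a0N] [au auN]; split.
  exists [:: \bot; a; u] => //; split; first by rewrite /= a0 au.
  move=> x; rewrite !inE => /or3P[]/eqP->; rewrite /itv /= ?le0x ?lexx //=.
  exact: ltW.
have Ia : itv \bot u a by rewrite /itv /= le0x ltW.
pose r (x : L) := ((a <= x)%O + (u <= x `|` a)%O)%N.
move=> s [] ss sX.
apply: (size_chain_rank (r := r)) ss sX => [x y Ix Iy xy|x _].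
  2: by rewrite /r; do 2!case: (_ <= _).
have [yu xu] : y <= u /\ x <= u by case/andP: Ix; case/andP: Iy.
have lxy := ltW xy.
have m1 : a <= x -> a <= y by move/le_trans; apply.
have m2 : u <= x `|` a -> u <= y `|` a.
  by move/le_trans; apply; rewrite leUx leUr lexUl.
(* Both tests in [r] are monotone, so either one switches on and the rank grows, or neither does;
   the latter forces [y <= x]. *)
have [/andP[e1 e2]|] := boolP (((a <= y) ==> (a <= x)) &&
                               ((u <= y `|` a) ==> (u <= x `|` a))); last first.
  rewrite /r; move: m1 m2; case: (a <= x); case: (a <= y);
  case: (u <= x `|` a); case: (u <= y `|` a) => // m1 m2;
  by [move: (m1 isT)|move: (m2 isT)|].
exfalso; have yx : y <= x.
  have am : a `&` y <= x.
    have [ay|nay] := boolP (a <= y).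
      by rewrite leIxl // (implyP e1).
    suff -> : a `&` y = \bot by apply: le0x.
    apply/eqP; apply: contraT; rewrite -lt0x => h.
    case: (a0N (a `&` y)); rewrite h lt_neqAle leIl andbT.
    by apply: contraNneq nay => <-; apply: leIr.
  have yj : y <= x `|` a.
    have [uy|nuy] := boolP (u <= y `|` a).
      exact: le_trans yu (implyP e2 uy).
    suff <- : y `|` a = x `|` a by apply: leUl.
    have ya : y `|` a = a.
      apply/eqP; apply: contraT => h.
      case: (auN (y `|` a)); rewrite !lt_neqAle eq_sym h leUr leUx yu (ltW au).
      by rewrite !andbT; apply: contraNneq nuy => ->.
    by rewrite ya (join_r (le_trans lxy _)) // -ya leUl.
  have := modu x a y Ix Ia Iy lxy.
  rewrite (join_l am) => ->; rewrite lexI lexx andbT.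
  exact: yj.
by move: xy; rewrite lt_neqAle => /andP[/eqP[]]; apply/le_anti; rewrite lxy yx.
Qed.

(** The modular law recovers any [x <= a] as the meet of [a] with the join of [x] and [b]. An [x]
    strictly between bottom and [a] would thus put that join strictly between [b] and [u]. *)
Lemma modular_covers_bot (L : tbLatticeType d) (a b u : L) :
  modular_sublattice (itv \bot u) -> a `&` b = \bot -> a `|` b = u ->
  covers b u -> a <> \bot -> covers \bot a.
Proof.
move=> [_ modu] ab ab' [_ buN] a0; split; first by rewrite lt0x; apply/eqP.
move=> x /andP[x0 xa].
have au : a <= u by rewrite -ab' leUl.
have bu : b <= u by rewrite -ab' leUr.
have I y : y <= u -> itv \bot u y by rewrite /itv /= le0x.
have xu := le_trans (ltW xa) au.
have := modu x b a (I _ xu) (I _ bu) (I _ au) (ltW xa).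
rewrite (meetC b) ab joinx0 => E.
case: (buN (x `|` b)); rewrite !lt_neqAle leUr leUx xu bu !andbT.
apply/andP; split; apply/eqP => E'.
  by move: x0; rewrite E -E' meetC ab ltxx.
by move: xa; rewrite [X in X < _]E E' (meet_r au) ltxx.
Qed.

End LatticeFacts.

(** * Projection kernels, overlined congruences and [Delta] on A(theta) *)

Section PairAlgebraFacts.
Context {S : signature} {A : algebra S} (theta : con A).
Local Notation P := (pair_algebra theta).

Definition pr1 (p : P) : A := (sval p).1.
Definition pr2 (p : P) : A := (sval p).2.

Lemma pr1_hom : hom pr1. Proof. by []. Qed.
Lemma pr2_hom : hom pr2. Proof. by []. Qed.

Lemma pr_theta (p : P) : theta (pr1 p) (pr2 p).
Proof. exact: svalP p. Qed.

Lemma pair_ext (p q : P) : pr1 p = pr1 q -> pr2 p = pr2 q -> p = q.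
Proof.
rewrite /pr1 /pr2; case: p q => [[a b] ab] [[a' b'] ab'] /= E E'.
by subst a' b'; rewrite (Prop_irrelevance ab ab').
Qed.

(** The coordinates of each pair are [theta]-related, so above [theta] either coordinate may define
    the overlined congruence. *)
Lemma overline_pr2 (beta : con A) (p q : P) :
  theta <= beta -> overline theta beta p q <-> beta (pr2 p) (pr2 q).
Proof.
move=> le.
have pb (r : P) : beta (pr1 r) (pr2 r) := con_le_app le (pr_theta r).
change (beta (pr1 p) (pr1 q) <-> beta (pr2 p) (pr2 q)); split=> pq.
  exact: con_trans (con_sym (pb p)) (con_trans pq (pb q)).
exact: con_trans (pb p) (con_trans pq (con_sym (pb q))).
Qed.

Lemma overline_abelian : abelian theta -> abelian (overline theta theta).
Proof.
move=> ab m n t a b c d Hab Hcd /= E; apply: pair_ext.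
  rewrite !(hom_env2 _ _ _ pr1_hom); apply: (ab _ _ t (pr1 \o a)) => //.
  by rewrite -!(hom_env2 _ _ _ pr1_hom) E.
rewrite !(hom_env2 _ _ _ pr2_hom); apply: (ab _ _ t (pr2 \o a)).
- by move=> i; apply/(overline_pr2 _ _ (lexx _))/Hab.
- by move=> j; apply/(overline_pr2 _ _ (lexx _))/Hcd.
by rewrite -!(hom_env2 _ _ _ pr2_hom) E.
Qed.

Lemma eta1_le (beta : con A) : eta1 theta <= overline theta beta.
Proof. by apply/con_leP => p q /= E; rewrite E; apply: con_refl. Qed.

Lemma eta2_le (beta : con A) :
  theta <= beta -> eta2 theta <= overline theta beta.
Proof.
move=> le; apply/con_leP => p q /= E; apply/overline_pr2 => //.
by rewrite /pr2 E; apply: con_refl.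
Qed.

Lemma Delta_diag (phi : con A) a b :
  phi a b -> Delta_con theta phi (diag theta a) (diag theta b).
Proof. by move=> ab; apply: Cg_gen; exists a, b. Qed.

Lemma Delta_le (phi : con A) : Delta_con theta phi <= overline theta phi.
Proof. by apply/con_leP; apply: Cg_min => _ _ [a [b [ab -> ->]]]. Qed.

Lemma eta1_diag (p : P) : eta1 theta p (diag theta (pr1 p)).
Proof. by []. Qed.

Lemma eta2_diag (p : P) : eta2 theta p (diag theta (pr2 p)).
Proof. by []. Qed.

(** The link runs through the diagonal: [p eta1 (p1,p1) gamma (q1,q1) eta1 q]. Leaving [gamma]
    general serves both [Delta] and epsilon. *)
Lemma eta1_joinP (beta : con A) (gamma : con P) :
  gamma <= overline theta beta ->
  (forall a b, beta a b -> gamma (diag theta a) (diag theta b)) ->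
  eta1 theta `|` gamma = overline theta beta.
Proof.
move=> le H; apply/le_anti/andP; split; first by rewrite leUx eta1_le.
apply/con_leP => p q pq.
apply: (@con_trans _ _ _ (diag theta (pr1 p) : P)).
  exact/con_joinl/eta1_diag.
apply: (@con_trans _ _ _ (diag theta (pr1 q) : P)).
  exact/con_joinr/H.
exact/con_joinl/con_sym/eta1_diag.
Qed.

Lemma eta2_joinP (beta : con A) (gamma : con P) :
  theta <= beta -> gamma <= overline theta beta ->
  (forall a b, beta a b -> gamma (diag theta a) (diag theta b)) ->
  eta2 theta `|` gamma = overline theta beta.
Proof.
move=> leb le H; apply/le_anti/andP; split; first by rewrite leUx eta2_le.
apply/con_leP => p q /(overline_pr2 _ _ leb) pq.
apply: (@con_trans _ _ _ (diag theta (pr2 p) : P)).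
  exact/con_joinl/eta2_diag.
apply: (@con_trans _ _ _ (diag theta (pr2 q) : P)).
  exact/con_joinr/H.
exact/con_joinl/con_sym/eta2_diag.
Qed.

Lemma eta12_join : eta1 theta `|` eta2 theta = overline theta theta.
Proof.
apply/le_anti/andP; split; first by rewrite leUx eta1_le eta2_le.
apply/con_leP => p q pq.
(* The intermediate pair [(p1,q2)] lies in A(theta) because [p1 theta q1 theta q2]. *)
have pq' : theta (pr1 p) (pr2 q) :=
  con_trans (pq : theta (pr1 p) (pr1 q)) (pr_theta q).
apply: (@con_trans _ _ _ (mkpair pq' : P)); first exact: con_joinl.
exact: con_joinr.
Qed.

Lemma eta12_meet : eta1 theta `&` eta2 theta = \bot.
Proof.
apply/le_anti; rewrite le0x andbT; apply/con_leP => p q /con_meetE[].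
exact: pair_ext.
Qed.

Local Notation alpha := (centralizer \bot theta).
Local Notation Delta := (Delta_con theta alpha).

Lemma Delta_saturates_diagonal (p q : P) :
  Delta p q -> pr1 p = pr2 p -> pr1 q = pr2 q.
Proof.
move=> pq; apply: (@syntactic_saturated _ P (fun r => pr1 r = pr2 r)).
move: p q pq.
apply: Cg_min => _ _ [a [b [ab -> ->]]] n t r.
have [C _] := centralizerP \bot theta.
(* At [(x,x)] the two coordinates of a test term differ only in the parameters, [pr1 \o r] against
   [pr2 \o r]. These are [theta]-related, so the term condition for [alpha] applies. *)
have E x : pr1 (eval (env2 (fun=> diag theta x : P) r) t) =
           pr2 (eval (env2 (fun=> diag theta x : P) r) t) <->
           eval (env2 (fun=> x) (pr1 \o r)) t =
           eval (env2 (fun=> x) (pr2 \o r)) t.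
  by rewrite (hom_env2 _ _ _ pr1_hom) (hom_env2 _ _ _ pr2_hom).
rewrite !E //; split; apply: C => // *; try exact: pr_theta.
exact: con_sym.
Qed.


Lemma Delta_diagP (a : A) (p : P) :
  Delta (diag theta a) p <-> exists2 b, alpha a b & p = diag theta b.
Proof.
split=> [Dp|[b ab ->]]; last exact: Delta_diag.
have E : pr1 p = pr2 p by apply: Delta_saturates_diagonal Dp _.
by exists (pr1 p); [exact: (con_le_app (Delta_le _) Dp)|exact: pair_ext].
Qed.

(** A congruence between [eta] and theta-bar is determined by its restriction to the diagonal, a
    congruence of [A] below [theta]. Keeping [pr] abstract covers both projections. *)
Lemma pair_covers (pr : P -> A) (eta : con P) :
  (forall a, pr (diag theta a) = a) ->
  (forall p q, eta p q <-> pr p = pr q) ->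
  (forall p q, overline theta theta p q <-> theta (pr p) (pr q)) ->
  covers \bot theta -> covers eta (overline theta theta).
Proof.
move=> prK etaE barE [theta0 theta0N]; split.
  rewrite lt_neqAle; apply/andP; split.
    apply: contraTN theta0 => /eqP E; rewrite lt0x negbK.
    apply/eqP/le_anti; rewrite le0x andbT; apply/con_leP => a b ab.
    rewrite -(prK a) -(prK b); apply/etaE; rewrite E; apply/barE.
    by rewrite !prK.
  apply/con_leP => p q /etaE E; apply/barE; rewrite E.
  exact: con_refl.
move=> gamma /andP[etag gbar].
have gE p q : gamma p q <-> gamma (diag theta (pr p)) (diag theta (pr q)).
  have e r : gamma r (diag theta (pr r)).
    by apply: (con_le_app (ltW etag)); apply/etaE; rewrite prK.
  split=> h; first exact: con_trans (con_sym (e p)) (con_trans h (e q)).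
  exact: con_trans (e p) (con_trans h (con_sym (e q))).
have diag_hom : hom (diag theta : A -> P) by move=> f x; apply: pair_ext.
pose beta := con_preim diag_hom gamma.
apply: (theta0N beta); rewrite lt0x lt_neqAle; apply/and3P; split.
- apply: contraTneq etag => E; apply/negP => /lt_geF/negbT/negP[].
  apply/con_leP => p q /gE h; apply/etaE.
  have : beta (pr p) (pr q) by [].
  by rewrite E.
- apply: contraTneq gbar => E; apply/negP => /lt_geF/negbT/negP[].
  apply/con_leP => p q /barE h; apply/gE.
  by have : beta (pr p) (pr q) by rewrite E.
apply/con_leP => a b h; have /barE := con_le_app (ltW gbar) h.
by rewrite !prK.
Qed.

(** * Consequences of the weak difference term for abelian [theta] *)

Section WeakDifference.
Context (d : term S 'I_3).
Context (d_wdt : weak_difference_term A d).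
Context (theta_abelian : abelian theta).

Lemma theta_malcev a b :
  theta a b -> eval3 d a a b = b /\ eval3 d b a a = b.
Proof.
case: d_wdt => _ H ab.
by have [E E'] := H \bot theta (le0x _) theta_abelian a b ab; split.
Qed.

Lemma overline_malcev p q :
  overline theta theta p q -> eval3 d p p q = q /\ eval3 d q p p = q.
Proof.
move=> pq; have pq' : theta (pr2 p) (pr2 q) by apply/overline_pr2.
have [E1 E2] := theta_malcev pq; have [E3 E4] := theta_malcev pq'.
by split; apply: pair_ext;
  rewrite ?(hom_eval3 _ _ _ _ pr1_hom) ?(hom_eval3 _ _ _ _ pr2_hom).
Qed.

(** Since [d(b,b,a) = a = d(c,b,a)], the term condition lets the last [a] become [b], whence
    [b = d(b,b,b) = d(c,b,b) = c]. *)
Lemma theta_cancel a b c :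
  theta a b -> theta b c -> eval3 d c b a = a -> b = c.
Proof.
move=> ab bc E; have [E1 _] := theta_malcev (con_sym ab).
have [E2 _] := theta_malcev (con_refl theta b).
have [_ E3] := theta_malcev bc.
rewrite -E3 -[LHS]E2; apply: (eval3_centralizes theta_abelian bc ab).
by rewrite /= E1 E.
Qed.

Lemma theta_le_alpha : theta <= alpha.
Proof. exact: centralizes_le. Qed.

(** The polynomial [d( - ,p,(e,e))] sends [p] to [(e,e)], so its value at [q] is [Delta]-related to
    a diagonal element and is itself diagonal. *)
Lemma Delta_difference (p q : P) e :
  Delta p q -> theta (pr1 p) e ->
  eval3 d (pr1 q) (pr1 p) e = eval3 d (pr2 q) (pr2 p) e.
Proof.
move=> pq pe; pose z : P := diag theta e.
have D : Delta (eval3 d p p z) (eval3 d q p z).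
  by apply: con_eval3 => //; apply: con_refl.
have := Delta_saturates_diagonal D.
rewrite !(hom_eval3 _ _ _ _ pr1_hom) !(hom_eval3 _ _ _ _ pr2_hom); apply.
have [-> _] := theta_malcev pe.
by have [-> _] := theta_malcev (con_trans (con_sym (pr_theta p)) pe).
Qed.

Lemma eta1_Delta (p q : P) : eta1 theta p q -> Delta p q -> p = q.
Proof.
move=> /= E pq; apply: pair_ext => //.
apply: (@theta_cancel (pr1 p)); first exact: pr_theta.
  apply: con_trans (con_sym (pr_theta p)) _.
  by rewrite /pr1 E; apply: pr_theta.
(* With [e] the common first coordinate, the left side of [Delta_difference] is [d(e,e,e) = e]. *)
rewrite -(Delta_difference pq (con_refl _ _)) /pr1 -E.
by case: d_wdt.
Qed.

Lemma eta2_Delta (p q : P) : eta2 theta p q -> Delta p q -> p = q.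
Proof.
move=> /= E pq; apply: pair_ext => //.
apply: (@theta_cancel (pr2 p)); first exact/con_sym/pr_theta.
  apply: con_trans (pr_theta p) _.
  by rewrite /pr2 E; apply/con_sym/pr_theta.
rewrite (Delta_difference pq (pr_theta _)) /pr2 -E.
by case: d_wdt.
Qed.

Lemma eta1_Delta_meet : eta1 theta `&` Delta = \bot.
Proof.
apply/le_anti; rewrite le0x andbT; apply/con_leP => p q /con_meetE[].
exact: eta1_Delta.
Qed.

Lemma eta2_Delta_meet : eta2 theta `&` Delta = \bot.
Proof.
apply/le_anti; rewrite le0x andbT; apply/con_leP => p q /con_meetE[].
exact: eta2_Delta.
Qed.

(* The difference term moves two elements with first coordinates [a] and [b],
   modulo Delta, to elements with common first coordinate [d(a,a,b)]. *)
Lemma overline_alpha_decomposition (p q : P) :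
  overline theta alpha p q ->
  exists p' q', [/\ Delta p p', eta1 theta p' q' & Delta q' q].
Proof.
move=> pq; pose a : P := diag theta (pr1 p); pose b : P := diag theta (pr1 q).
have ab : Delta a b by apply: Delta_diag.
exists (eval3 d p a b).
exists (eval3 d a a q); split.
- have [_ E] := overline_malcev (p := a) (q := p) (con_refl theta _).
  by rewrite -[X in Delta X]E; apply: con_eval3 => //; apply: con_refl.
- change (pr1 (eval3 d p a b) =
          pr1 (eval3 d a a q)).
  by rewrite !(hom_eval3 _ _ _ _ pr1_hom).
have [E _] := overline_malcev (p := b) (q := q) (con_refl theta _).
by rewrite -[X in Delta _ X]E; apply: con_eval3 => //; apply: con_refl.
Qed.

(** By the decomposition only [eta1] has to be tested. Inside [eta1], [Delta] is equality, so it is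
    enough that [eta1] lies below the abelian theta-bar. *)
Lemma overline_alpha_abelian_mod :
  centralizes (overline theta alpha) (overline theta alpha) Delta.
Proof.
apply: (centralizes_saturate overline_alpha_decomposition
                             overline_alpha_decomposition).
move=> m n t a b c c' ab cc' h.
have E : eval (env2 a c) t = eval (env2 a c') t.
  apply: eta1_Delta h; apply: con_eval => -[i|j]; last exact: cc'.
  exact: con_refl.
have -> : eval (env2 b c) t = eval (env2 b c') t; last exact: con_refl.
have C := centralizes_mono (eta1_le theta) (eta1_le theta)
                           (overline_abelian theta_abelian).
exact: (C _ _ t a).
Qed.

(** An equation of [A] at [pr1 p] is lifted to A(theta), carried from [p] to [q] by [C], and read
    off at [pr2 q]. Abelianness of [theta] passes between the coordinates of [p] and of [q]. *)
Lemma centralizes_overline_alpha (phi : con P) :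
  centralizes phi (overline theta alpha) Delta -> phi <= overline theta alpha.
Proof.
move=> C; suff H p q : phi p q -> forall m n (t : term S ('I_m + 'I_n)) i x
    (c c' : 'I_n -> A), (forall j, theta (c j) (c' j)) ->
    eval (env2 (upd x i (pr1 p)) c) t = eval (env2 (upd x i (pr1 p)) c') t ->
    eval (env2 (upd x i (pr1 q)) c) t = eval (env2 (upd x i (pr1 q)) c') t.
  apply/con_leP => p q pq; apply/centralizer_exchangeable => m n t i x c c' cc'.
  by split; apply: H => //; apply: con_sym.
move=> pq m n t i x c c' cc' E.
pose u (r : P) (k : 'I_m) : P := upd (fun k => diag theta (x k) : P) i r k.
(* [y] and [y'] share first coordinates, so they are related by alpha-bar and only the second
   coordinate of the lifted equation, which compares [c] with [c'], has content. *)
pose y j : P := diag theta (c j).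
pose y' j : P := mkpair (cc' j).
have u1 r : pr1 \o u r = upd x i (pr1 r).
  by apply/funext => k; rewrite /u /upd /=; case: eqP.
have u2 r : pr2 \o u r = upd x i (pr2 r).
  by apply/funext => k; rewrite /u /upd /=; case: eqP.
have transfer a b : theta a b ->
    eval (env2 (upd x i a) c) t = eval (env2 (upd x i a) c') t ->
    eval (env2 (upd x i b) c) t = eval (env2 (upd x i b) c') t.
  move=> ab; apply: theta_abelian => // k.
  by rewrite /upd; case: eqP => // _; apply: con_refl.
have Ep : eval (env2 (u p) y) t = eval (env2 (u p) y') t.
  apply: pair_ext.
    by rewrite !(hom_env2 _ _ _ pr1_hom).
  rewrite !(hom_env2 _ _ _ pr2_hom) u2.
  exact: transfer (pr_theta p) E.
have Eq : eval (env2 (u q) y) t = eval (env2 (u q) y') t.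
  apply: eta1_Delta.
    change (pr1 (eval (env2 (u q) y) t) = pr1 (eval (env2 (u q) y') t)).
    by rewrite !(hom_env2 _ _ _ pr1_hom).
  apply: (C _ _ t (u p)).
  - by move=> k; rewrite /u /upd; case: eqP => // _; apply: con_refl.
  - by move=> j; apply: (con_refl alpha (c j)).
  by rewrite Ep; apply: con_refl.
apply: transfer (con_sym (pr_theta q)) _.
have := congr1 pr2 Eq.
by rewrite !(hom_env2 _ _ _ pr2_hom) u2.
Qed.

Lemma centralizer_Delta : centralizer Delta (overline theta alpha) =
  overline theta alpha.
Proof.
apply/le_anti/andP; split; last exact/centralizes_le/overline_alpha_abelian_mod.
apply: centralizes_overline_alpha.
by have [] := centralizerP Delta (overline theta alpha).
Qed.

(** If [a theta b] with [a] and [b] distinct, alpha-bar relates [(a,a)] to [(a,b)], whereas [Delta]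
    relates diagonal elements only to diagonal ones. *)
Lemma Delta_lt : theta <> \bot -> Delta < overline theta alpha.
Proof.
move=> theta0; rewrite lt_neqAle Delta_le andbT; apply/eqP => E; apply: theta0.
apply/le_anti; rewrite le0x andbT; apply/con_leP => a b ab.
apply: (@Delta_saturates_diagonal (diag theta a) (mkpair ab)) => //.
by rewrite E; apply: (con_refl alpha a).
Qed.

End WeakDifference.
End PairAlgebraFacts.

(** * Assembly of the six assertions about [Delta] and the interval below theta-bar *)

Theorem theorem4p6 (S : signature) (V : set (algebra S)) (A : algebra S)
    (theta : con A)
    (V_variety : variety V) (V_wdt : has_weak_difference_term V) (VA : V A)
    (theta_neq0 : theta <> \bot) (theta_abelian : abelian theta) :
  let alpha : con A := centralizer \bot theta in
  let Delta : con (pair_algebra theta) := Delta_con theta alpha in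
  let eta1 : con (pair_algebra theta) := eta1 theta in
  let eta2 : con (pair_algebra theta) := eta2 theta in
  let thetabar : con (pair_algebra theta) := overline theta theta in
  let alphabar : con (pair_algebra theta) := overline theta alpha in
  let eps : con (pair_algebra theta) := thetabar `&` Delta in
  let I0thetabar : set (con (pair_algebra theta)) := itv \bot thetabar in
  let X : set (con (pair_algebra theta)) :=
    [set \bot; eta1; eta2; eps; thetabar]%classic in
  (forall (a : A) (p : pair_algebra theta),
     Delta (diag theta a) p <-> exists2 b, alpha a b & p = diag theta b) /\
  (Delta < alphabar /\ centralizer Delta alphabar = alphabar) /\
  (abelian thetabar /\ modular_sublattice I0thetabar /\
   forall phi psi, I0thetabar phi -> I0thetabar psi -> permute phi psi) /\
  ((forall x, X x -> I0thetabar x) /\ sublattice_isomorphic_to M3 X) /\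
  (transposes_up eps thetabar Delta alphabar /\
   transposes_up \bot eta1 Delta alphabar /\
   transposes_up \bot eta2 Delta alphabar) /\
  (covers \bot theta ->
   has_height I0thetabar 2 /\ covers Delta alphabar /\
   completely_meet_irreducible Delta).
Proof.
have [d dV] := V_wdt; have dA := dV A VA.
move=> alpha Delta eta1' eta2' thetabar alphabar eps I0 X.
have le_alpha : theta <= alpha := theta_le_alpha theta_abelian.
have bars : thetabar <= alphabar.
  by apply/con_leP => p q h; apply: (con_le_app le_alpha h).
have malcev := overline_malcev dA theta_abelian.
have perm phi psi : I0 phi -> I0 psi -> permute phi psi.
  by move=> /andP[_ h] /andP[_ k]; apply: malcev_permute malcev h k.
have modu := permute_modular_sublattice perm.
have m12 : eta1' `&` eta2' = \bot := eta12_meet theta.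
have j12 : eta1' `|` eta2' = thetabar := eta12_join theta.
have m1D : eta1' `&` Delta = \bot := eta1_Delta_meet dA theta_abelian.
have m2D : eta2' `&` Delta = \bot := eta2_Delta_meet dA theta_abelian.
have DleA : Delta <= alphabar := Delta_le theta alpha.
have j1D : eta1' `|` Delta = alphabar.
  by apply: eta1_joinP => // a b; apply: Delta_diag.
have j2D : eta2' `|` Delta = alphabar.
  by apply: eta2_joinP => // a b; apply: Delta_diag.
have eps_diag a b : theta a b -> eps (diag theta a) (diag theta b).
  move=> ab; apply/con_meetE; split=> //.
  exact/Delta_diag/(con_le_app le_alpha).
have j1e : eta1' `|` eps = thetabar by apply: eta1_joinP => //; apply: leIl.
have j2e : eta2' `|` eps = thetabar by apply: eta2_joinP => //; apply: leIl.
have eta_t1 : eta1' <= thetabar := eta1_le theta theta.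
have eta_t2 : eta2' <= thetabar := eta2_le (lexx theta).
have m1e : eta1' `&` eps = \bot by rewrite meetA (meet_l eta_t1).
have m2e : eta2' `&` eps = \bot by rewrite meetA (meet_l eta_t2).
have DltA : Delta < alphabar := Delta_lt theta_neq0.
have cD : centralizer Delta alphabar = alphabar :=
  centralizer_Delta dA theta_abelian.
have bar0 : \bot <> thetabar.
  move=> E; apply: theta_neq0; apply/le_anti; rewrite le0x andbT.
  apply/con_leP => a b ab.
  have : thetabar (diag theta a) (diag theta b) := ab.
  by rewrite -E => /(congr1 (@pr1 _ _ theta)).
split; first exact: Delta_diagP.
split; first by [].
split; first by split=> //; apply: overline_abelian.
split.
  split; last exact: sublattice_isomorphic_to_M3.
  by move=> x [[[[]|]|]|] ->; apply/andP; split; rewrite ?le0x ?leIl.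
split.
  split; last by split; split; rewrite ?le0x.
  split=> //; first exact: leIl.
  (* [alphabar] is already the join of [Delta] with [eta1'], which lies below [thetabar]. *)
  apply/le_anti; rewrite leUx bars DleA /= -j1D.
  by rewrite leUx leUr (le_trans eta_t1) ?leUl.
move=> theta_min.
have c1 : covers eta1' thetabar by apply: (pair_covers (pr := @pr1 _ _ theta)).
have c2 : covers eta2' thetabar.
  apply: (pair_covers (pr := @pr2 _ _ theta)) => // p q.
  exact: overline_pr2.
(* [eta1'] and [eta2'] are complements in the interval, so the cover of [eta2'] by [thetabar]
   transposes down. *)
have c0 : covers \bot eta1'.
  apply: (modular_covers_bot modu m12 j12 c2) => E.
  by case: (c2) => + _; rewrite -j12 E join0x ltxx.
have cDA : covers Delta alphabar.
  split=> // gamma /andP[Dg gA].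
  (* As bottom is covered by [eta1'], the meet with [gamma] is [eta1'] or bottom. In the first case
     [gamma] contains the join of [eta1'] and [Delta], which is [alphabar]. *)
  have [E|n1] := eqVneq (eta1' `&` gamma) eta1'.
    have e1 : eta1' <= gamma by rewrite -E leIr.
    by move: (lt_geF gA); rewrite -j1D leUx e1 ltW.
  have [E|n0] := eqVneq (eta1' `&` gamma) \bot; last first.
    by case: c0 => _ /(_ (eta1' `&` gamma)); rewrite lt0x n0 lt_neqAle n1 leIl.
  (* Up to [Delta], each pair of [gamma] becomes a pair of the trivial meet, hence lies in
     [Delta]. *)
  have gD : gamma <= Delta.
    apply/con_leP => p q pq.
    have [p' [q' [pp' p'q' q'q]]] := overline_alpha_decomposition dA
      theta_abelian (con_le_app (ltW gA) pq).
    have gp'q' : gamma p' q'.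
      apply: con_trans (con_sym (con_le_app (ltW Dg) pp')) _.
      exact: con_trans pq (con_sym (con_le_app (ltW Dg) q'q)).
    have : (eta1' `&` gamma) p' q' by apply/con_meetE.
    by rewrite E => /con_botE e; apply: con_trans pp' _; rewrite e.
  by move: (lt_geF Dg); rewrite gD.
split; first exact: modular_height2 modu c0 c1.
split=> //; split.
  by move=> E; move: (lt_geF DltA); rewrite E lex1.
exists alphabar => // gamma Dg.
have [//|nle] := boolP (alphabar <= gamma).
have E : gamma `&` alphabar = Delta.
  apply/eqP; apply: contraT => ne; case: cDA => _ /(_ (gamma `&` alphabar)) [].
  rewrite !lt_neqAle eq_sym ne lexI (ltW Dg) DleA leIr /= andbT.
  by apply/eqP => e; move/negP: nle; apply; rewrite -e leIl.
have gA : gamma <= alphabar.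
  rewrite -cD; apply: centralizes_le; rewrite -E.
  exact: centralizes_meet.
by move: Dg; rewrite -E (meet_l gA) ltxx.
Qed.
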